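(* Let $\bar X_n$ be the number of descendants of a node chosen uniformly at random from the inserted nodes $\{1,\dots,n\}$ of a random ordered increasing $k$-tree of size $n\ge1$. Then for $m\ge1$, \[ \mathbb{P}\{\bar X_n=m\}=\frac{\binom{m-1-\frac1{k+1}}{m-1}}{n\binom{n-\frac{k}{k+1}}{n}}\sum_{\ell=0}^{m-1}\frac{\binom{m-1}{\ell}(-1)^\ell}{(k+1)(\ell+1)+k}\left(\binom{n+\frac1{k+1}}{n}-\binom{n-\ell-2+\frac2{k+1}}{n}\right). \] As $n\to\infty$, $\bar X_n$ converges in distribution to a discrete random variable $\bar X$ with \[ \mathbb{P}\{\bar X=m\}=\frac{k}{(k+1)(m+\frac{k}{k+1})(m-\frac1{k+1})},\quad m\ge1. \]
   Context: Fix an integer $k\ge1$. An ordered increasing $k$-tree of size $n\ge0$ is built as follows. Start with the root-clique $K_0$: $k$ pairwise adjacent vertices labelled $0_1,\dots,0_k$ (the root nodes; each label $0_\ell$ has value $0$). For $j=1,\dots,n$ in turn, node $j$ is inserted by choosing a currently existing $k$-clique $K$ and attaching $j$ to it, i.e. adding edges from $j$ to all $k$ vertices of $K$; $j$ is then a child of $K$ and the vertices of $K$ are the parents of $j$. The $k$-cliques available for attachment are the root-clique and, for every previously inserted node $x$ attached to a clique $K'$, the $k$ cliques $\{x\}\cup(K'\setminus\{w\})$, $w\in K'$. The children of each $k$-clique are linearly ordered: if $K$ currently has $d^+(K)$ children, there are $d^+(K)+1$ positions at which the new child may be placed, and the choice of position is part of the structure. Thus there are $1+(k+1)(j-1)$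 ways to insert node $j$, and distinct sequences of choices give distinct trees. A random ordered increasing $k$-tree of size $n$ is one chosen uniformly among all of them; equivalently, it is produced by the process in which node $n$ is attached to the clique $K$ with probability $\frac{d^+(K)+1}{1+(k+1)(n-1)}$ (and a uniformly random position among the $d^+(K)+1$). A node $w$ is a descendant of $u$ if $w=u$ or some parent of $w$ is a descendant of $u$ (so $u$ counts as its own descendant). For real $x$ and integer $m\ge0$, $\binom{x}{m}=x(x-1)\cdots(x-m+1)/m!$, and $\binom{x}{m}=0$ for $m<0$. *)

(* Defs.v *)
From HB Require Import structures.
From mathcomp Require Import all_boot all_order all_algebra.
Set Implicit Arguments. Unset Strict Implicit. Unset Printing Implicit Defensive.
Import Order.TTheory GRing.Theory Num.Theory.

Definition binr (x : rat) (m : nat) : rat :=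
  ((\prod_(i < m) (x - (i : nat)%:R)) / (m`!)%:R)%R.

(* Vertices: inl l = root node 0_(l+1) (l < k), inr j = inserted node j (j >= 1). *)
Definition vtx := (nat + nat)%type.

(* A tree of size n is encoded by its sequence of insertion choices:
   the j-th entry (j = 1..n, stored at index j-1) is (c, p), where c is the
   index of the k-clique node j is attached to and p is its position among the
   children of that clique.
   Clique indexing: clique 0 is the root clique; for an inserted node x,
   cliques 1 + k*(x-1) + w (w < k) are {x} ∪ (K' \ {w-th vertex of K'}),
   where K' is the clique x is attached to. *)

Definition rootclique (k : nat) : seq vtx := [seq inl l | l <- iota 0 k].

(* vertex list of clique c (fuel-driven; parent clique indices are strictly smaller) *)
Fixpoint cverts_aux (k : nat) (s : seq (nat * nat)) (fuel c : nat) : seq vtx :=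
  match fuel with
  | 0 => [::]
  | f.+1 =>
    if c == 0 then rootclique k else
    let x := (c.-1 %/ k).+1 in
    let w := c.-1 %% k in
    let K' := cverts_aux k s f (nth (0, 0) s x.-1).1 in
    inr x :: (take w K' ++ drop w.+1 K')
  end.

Definition cverts k s c := cverts_aux k s c.+1 c.

Definition parents k (s : seq (nat * nat)) (x : nat) : seq vtx :=
  cverts k s (nth (0, 0) s x.-1).1.

(* w is a descendant of u: w = u or some parent of w is a descendant of u.
   (Parents of w have smaller labels, so the recursion with fuel w is exact.) *)
Fixpoint desc_aux k (s : seq (nat * nat)) (u fuel w : nat) : bool :=
  match fuel with
  | 0 => false
  | f.+1 => (w == u) ||
      has (fun v => match v with inl _ => false | inr y => desc_aux k s u f y end)
          (parents k s w)
  end.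

Definition is_desc k s u w := desc_aux k s u w w.

Definition ndesc k (s : seq (nat * nat)) (u : nat) : nat :=
  count (is_desc k s u) (iota 1 (size s)).

(* all ordered increasing k-trees of size n, as choice sequences:
   node j+1 chooses one of the 1 + k*j existing cliques c and one of the
   d^+(c)+1 positions among the current children of c. *)
Fixpoint trees (k n : nat) : seq (seq (nat * nat)) :=
  match n with
  | 0 => [:: [::]]
  | j.+1 =>
    flatten [seq [seq rcons s (c, p) | c <- iota 0 (1 + k * j),
                   p <- iota 0 (count (fun q : nat * nat => q.1 == c) s).+1]
            | s <- trees k j]
  end.

Definition probXbar (k n m : nat) : rat :=
  ((\sum_(s <- trees k n) (count (fun u => ndesc k s u == m) (iota 1 n))%:R)
    / (n * size (trees k n))%:R)%R.

(* Main.v *)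
Require Import Defs.
From HB Require Import structures.
From mathcomp Require Import all_boot all_order all_algebra.
From mathcomp Require Import zify ring lra.
Set Implicit Arguments. Unset Strict Implicit. Unset Printing Implicit Defensive.
Import Order.TTheory GRing.Theory Num.Theory.

(* A clique contains a descendant of u exactly when its most recent vertex, the
   owner, is a descendant of u.  A node u with d descendants thus has k d cliques
   below it, which carry d - 1 children, so (k+1) d - 1 of the 1 + (k+1) n ways
   to insert node n+1 give u a new descendant.  This is a recurrence for the
   number of pairs (tree, u) where u has m descendants; alternating binomial sums
   of two products, each obeying a first-order recurrence in n, solve it.
   In the limit the product depending on l is of lower order, every difference
   tends to k+1 after normalisation, and the remaining sum over l is the partial
   fraction expansion of m! / (x (x+1) ... (x+m)) at x = 2 - 1/(k+1). *)

(** * Cliques, their owners and descendants *)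

Definition owner (k c : nat) : nat := (c.-1 %/ k).+1.

(** Index j belongs to node j+1, which finds the cliques 0, ..., k j. Past the end of [s] the
    default (0, 0) satisfies the bound, so j needs no range. *)
Definition wf_choices (k : nat) (s : seq (nat * nat)) : Prop :=
  forall j, (nth (0, 0) s j).1 <= k * j.

(** The guard excludes the root clique, for which [owner] returns the junk value 1. *)
Definition clique_below k (s : seq (nat * nat)) (u c : nat) : bool :=
  (0 < c) && is_desc k s u (owner k c).

Lemma owner_le k c x : 0 < k -> 0 < c -> c <= k * x -> owner k c <= x.
Proof.
move=> k0 c0 cx; rewrite /owner ltn_divLR //; lia.
Qed.

Lemma leq_owner k c : 0 < k -> 0 < c -> k * (owner k c).-1 < c.
Proof.
move=> k0 c0; rewrite /owner /= mulnC; have := leq_divM c.-1 k; lia.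
Qed.

(** The recursion passes from c to the clique its owner was attached to, whose index is smaller than
    c; any fuel above c therefore suffices. *)
Lemma cverts_aux_fuel k s f1 f2 c : 0 < k -> wf_choices k s ->
  c < f1 -> c < f2 -> cverts_aux k s f1 c = cverts_aux k s f2 c.
Proof.
move=> k0 wf; elim: f1 f2 c => [//|f1 IH] [//|f2] c; rewrite !ltnS => h1 h2 /=.
case: eqP => // /eqP c0.
have lt_c : (nth (0, 0) s (c.-1 %/ k)).1 < c.
  by apply: leq_ltn_trans (wf _) _; apply: leq_owner => //; rewrite lt0n.
by rewrite (IH f2) //; apply: leq_trans lt_c _.
Qed.

Lemma cvertsE k s c : 0 < k -> wf_choices k s -> 0 < c ->
  cverts k s c = inr (owner k c) ::
    (take (c.-1 %% k) (parents k s (owner k c)) ++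
     drop (c.-1 %% k).+1 (parents k s (owner k c))).
Proof.
move=> k0 wf c0; rewrite /cverts /parents [in LHS]/= ifF; last by lia.
have lt_c : (nth (0, 0) s (c.-1 %/ k)).1 < c.
  by apply: leq_ltn_trans (wf _) _; exact: leq_owner.
by rewrite (@cverts_aux_fuel _ _ _ (nth (0, 0) s (c.-1 %/ k)).1.+1).
Qed.

Lemma mem_sub_drop (T : eqType) (s : seq T) i x :
  x \in take i s ++ drop i.+1 s -> x \in s.
Proof. by rewrite mem_cat => /orP[/mem_take|/mem_drop]. Qed.

(** Vertices other than the owner lie in an earlier clique, and [owner] is monotone in the clique
    index. *)
Lemma cverts_bound k s c y : 0 < k -> wf_choices k s ->
  inr y \in cverts k s c -> [/\ 0 < c, 0 < y & y <= owner k c].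
Proof.
move=> k0 wf; elim/ltn_ind: c => c IH.
have [->|c0] := posnP c.
  by rewrite /cverts /= /rootclique => /mapP[].
rewrite cvertsE // inE => /orP[/eqP[->] //|/mem_sub_drop].
have lt_c : (nth (0, 0) s (c.-1 %/ k)).1 < c.
  by apply: leq_ltn_trans (wf _) _; exact: leq_owner.
rewrite /parents /= => /(IH _ lt_c)[c'0 y0 le_y]; split=> //.
apply: leq_trans le_y _; rewrite /owner.
by rewrite ltnS leq_div2r //; lia.
Qed.

Lemma parents_lt k s w y : 0 < k -> wf_choices k s -> 0 < w ->
  inr y \in parents k s w -> 0 < y < w.
Proof.
move=> k0 wf w0 /cverts_bound[] // c0 -> /leq_ltn_trans; apply.
by have := owner_le k0 c0 (wf w.-1); lia.
Qed.

Lemma desc_aux_fuel k s u f1 f2 w : 0 < k -> wf_choices k s -> 0 < w ->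
  w <= f1 -> w <= f2 -> desc_aux k s u f1 w = desc_aux k s u f2 w.
Proof.
move=> k0 wf; elim: f1 f2 w => [|f1 IH] [|f2] w w0 h1 h2; try by lia.
rewrite /=; congr (_ || _); apply: eq_in_has => -[//|y] y_in.
by have /andP[y0 lt_yw] := parents_lt k0 wf w0 y_in; apply: IH; lia.
Qed.

Lemma is_desc_rec k s u w : 0 < k -> wf_choices k s -> 0 < w ->
  is_desc k s u w = (w == u) || has (fun v => if v is inr y then
     is_desc k s u y else false) (parents k s w).
Proof.
move=> k0 wf; case: w => // w _; rewrite /is_desc /=; congr (_ || _).
apply: eq_in_has => -[//|y] y_in.
have /andP[y0 lt_yw] := parents_lt k0 wf (ltn0Sn w) y_in; exact: desc_aux_fuel.
Qed.

(* If some vertex of a clique other than its owner x is a descendant of u,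
   it is a parent of x, so x is a descendant of u as well. *)
Lemma is_descE k s u w : 0 < k -> wf_choices k s -> 0 < w ->
  is_desc k s u w = (w == u) || clique_below k s u (nth (0, 0) s w.-1).1.
Proof.
move=> k0 wf w0; rewrite is_desc_rec //; congr (_ || _).
rewrite /parents /clique_below; move: (nth _ _ _).1 => c.
have [->|c0] := posnP c.
  by apply/negbTE/hasPn => v; rewrite /cverts /= => /mapP[? _ ->].
rewrite cvertsE //= orb_idr //.
move=> /hasP[v /mem_sub_drop v_in dv]; rewrite is_desc_rec //.
by apply/orP; right; apply/hasP; exists v.
Qed.

Lemma is_desc_ge k s u w : 0 < k -> wf_choices k s -> 0 < w ->
  is_desc k s u w -> u <= w.
Proof.
move=> k0 wf; elim/ltn_ind: w => w IH w0.
rewrite is_descE // => /orP[/eqP->//|/andP[c0 dw]].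
have ltw : owner k (nth (0, 0) s w.-1).1 < w.
  by have := owner_le k0 c0 (wf w.-1); lia.
exact: leq_trans (IH _ ltw _ dw) (ltnW ltw).
Qed.

(** Makes the two alternatives of [is_descE] exclusive, so that counting descendants turns the
    disjunction into a sum. *)
Lemma clique_below_self k s u : 0 < k -> wf_choices k s -> 0 < u ->
  clique_below k s u (nth (0, 0) s u.-1).1 = false.
Proof.
move=> k0 wf u0; apply/negP => /andP[c0 /is_desc_ge].
have := owner_le k0 c0 (wf u.-1) => le h.
by have := h k0 wf isT; lia.
Qed.

(** * Effect of one insertion on descendants *)

Lemma wf_rcons k s c p : wf_choices k s -> c <= k * size s ->
  wf_choices k (rcons s (c, p)).
Proof.
move=> wf le_c j; rewrite nth_rcons; by case: ltngtP => [_|_|->]; first exact: wf.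
Qed.

Lemma is_desc_rcons k s c p u w : 0 < k -> wf_choices k s ->
  c <= k * size s -> 0 < w <= size s ->
  is_desc k (rcons s (c, p)) u w = is_desc k s u w.
Proof.
move=> k0 wf le_c; have wf' := wf_rcons p wf le_c.
elim/ltn_ind: w => w IH /andP[w0 le_w].
rewrite !is_descE //; congr (_ || _); rewrite nth_rcons ifT; last by lia.
rewrite /clique_below; case: posnP => //= c0.
have le := owner_le k0 c0 (wf w.-1).
by apply: IH; [|apply/andP; split=> //]; lia.
Qed.

Lemma iota1S n : iota 1 n.+1 = iota 1 n ++ [:: n.+1].
Proof. by rewrite -[in LHS](addn1 n) iotaD add1n. Qed.

(** Earlier nodes keep their status; the new node, whose label exceeds u, counts exactly when its
    clique lies below u. *)
Lemma ndesc_rcons k s c p u : 0 < k -> wf_choices k s ->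
  c <= k * size s -> 0 < u <= size s ->
  ndesc k (rcons s (c, p)) u = ndesc k s u + clique_below k s u c.
Proof.
move=> k0 wf le_c /andP[u0 le_u]; have wf' := wf_rcons p wf le_c.
rewrite /ndesc size_rcons iota1S count_cat /= addn0.
congr (_ + _).
  apply: eq_in_count => w; rewrite mem_iota => w_in.
  by rewrite is_desc_rcons //; lia.
rewrite is_descE // nth_rcons ltnn eqxx /= gtn_eqF //=.
rewrite /clique_below; case: posnP => //= c0.
by rewrite is_desc_rcons ?(owner_le k0 c0 le_c).
Qed.

Lemma ndesc_last k s : 0 < k -> wf_choices k s -> 0 < size s ->
  ndesc k s (size s) = 1.
Proof.
move=> k0 wf n0; rewrite /ndesc -{2}(prednK n0) iota1S.
rewrite count_cat /= addn0 prednK // is_descE // eqxx /=.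
rewrite (eq_in_count (a2 := pred0)) ?count_pred0 // => w.
rewrite mem_iota => w_in; apply/negP => /is_desc_ge.
by move=> /(_ k0 wf); lia.
Qed.

Lemma wf_nil k : wf_choices k [::].
Proof. by move=> j; rewrite nth_nil. Qed.

Lemma treesP k n s : s \in trees k n -> size s = n /\ wf_choices k s.
Proof.
elim: n s => [|n IH] s.
  by rewrite /= inE => /eqP->; split=> //; exact: wf_nil.
case/flattenP => _ /mapP[t /IH[sz wf] ->] /allpairsPdep[c [p [c_in _ ->]]].
rewrite size_rcons sz; split=> //; apply: wf_rcons => //.
by rewrite sz; move: c_in; rewrite mem_iota; lia.
Qed.

(** * Counting the ways to insert a node *)

Lemma choice_le k s q : wf_choices k s -> q \in s -> q.1 <= k * size s.
Proof.
move=> wf /(nthP (0, 0))[i lt_i <-]; apply: leq_trans (wf i) _.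
by rewrite leq_mul2l ltnW ?orbT.
Qed.

(** Double counting: a clique has one position to start with and gains one for each of its
    children. *)
Lemma sum_weight k s (g : nat -> bool) : wf_choices k s ->
  \sum_(c <- iota 0 (1 + k * size s)) (count (fun q => q.1 == c) s).+1 * g c =
  \sum_(c <- iota 0 (1 + k * size s)) g c + \sum_(q <- s) g q.1.
Proof.
move=> wf; rewrite (eq_bigr (fun c => g c + count (fun q => q.1 == c) s * g c));
  last by move=> c _; rewrite mulSn.
rewrite big_split /=; congr (_ + _).
under eq_bigr do rewrite -sum1_count big_mkcond big_distrl /=.
rewrite exchange_big; apply: eq_big_seq => q q_in.
have q1_in : q.1 \in iota 0 (1 + k * size s).
  by rewrite mem_iota /= add0n add1n ltnS; exact: choice_le wf q_in.
rewrite (bigD1_seq q.1 q1_in (iota_uniq _ _)).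
rewrite /= eqxx mul1n big1 ?addn0 // => c.
by rewrite eq_sym => /negbTE->.
Qed.

(** The cliques owned by x form the block of k indices from k(x-1)+1 to k x. *)
Lemma sum_owner k n (g : nat -> bool) : 0 < k ->
  \sum_(c <- iota 1 (k * n)) g (owner k c) = k * \sum_(x <- iota 1 n) g x.
Proof.
move=> k0; elim: n => [|n IH]; first by rewrite muln0 !big_nil muln0.
rewrite mulnS addnC iotaD iota1S !big_cat /= IH mulnDr; congr (_ + _).
rewrite big_seq1 (eq_big_seq (fun=> g n.+1 : nat)); last first.
  move=> c; rewrite mem_iota => c_in; congr (nat_of_bool (g _)).
  rewrite /owner (_ : c.-1 = n * k + (c.-1 - n * k)); last by lia.
  by rewrite divnMDl // divn_small ?addn0 //; lia.
by rewrite big_const_seq count_predT size_iota iter_addn_0 mulnC.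
Qed.

Lemma sum_choice (g : nat -> bool) s :
  \sum_(q <- s) g q.1 = \sum_(w <- iota 1 (size s)) g (nth (0, 0) s w.-1).1.
Proof.
by rewrite (big_nth (0, 0)) (iotaDl 1 0) big_map /index_iota subn0.
Qed.

Lemma ndesc_sum k s u :
  ndesc k s u = \sum_(w <- iota 1 (size s)) is_desc k s u w.
Proof. by rewrite /ndesc -sum1_count big_mkcond. Qed.

(** For d descendants there are k d cliques below u, and their children are the d - 1 descendants
    other than u. The successor on the left avoids truncated subtraction. *)
Lemma sum_weight_below k s u : 0 < k -> wf_choices k s -> 0 < u <= size s ->
  (\sum_(c <- iota 0 (1 + k * size s))
     (count (fun q => q.1 == c) s).+1 * clique_below k s u c).+1 =
  k.+1 * ndesc k s u.
Proof.
move=> k0 wf u_in; rewrite sum_weight // big_cons /= add0n.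
rewrite (eq_big_seq (fun c => is_desc k s u (owner k c) : nat)); last first.
  by move=> c; rewrite mem_iota /clique_below => /andP[->].
rewrite sum_owner // -ndesc_sum mulSn -addnS addnC; congr (_ + _).
(* The added 1 is written as the indicator sum of w = u, which supplies the first alternative of
   [is_descE]. *)
have sum_self : \sum_(w <- iota 1 (size s)) (w == u) = 1.
  have := count_uniq_mem u (iota_uniq 1 (size s)).
  by rewrite mem_iota add1n ltnS u_in -sum1_count big_mkcond.
rewrite (sum_choice (clique_below k s u)) ndesc_sum -[LHS]add1n.
rewrite -[X in X + _]sum_self -big_split.
apply: eq_big_seq => w; rewrite mem_iota => /andP[w0 _] /=; rewrite is_descE //.
by case: eqP w0 => [->|_] w0; rewrite ?clique_below_self.
Qed.

Lemma sum_weight_total k s : wf_choices k s ->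
  \sum_(c <- iota 0 (1 + k * size s)) (count (fun q => q.1 == c) s).+1 =
  1 + k.+1 * size s.
Proof.
move=> wf; have := sum_weight (fun=> true) wf.
rewrite (eq_bigr (fun c => (count (fun q => q.1 == c) s).+1)); last first.
  by move=> c _; rewrite muln1.
by move=> ->; rewrite !sum1_size size_iota mulSn; lia.
Qed.

Lemma sum_trees (V : nmodType) k n (F : seq (nat * nat) -> V) :
  (\sum_(s <- trees k n.+1) F s = \sum_(s <- trees k n)
     \sum_(c <- iota 0 (1 + k * n))
       \sum_(p <- iota 0 (count (fun q : nat * nat => q.1 == c) s).+1)
         F (rcons s (c, p)))%R.
Proof.
rewrite {1}/trees -/(trees k n) big_flatten big_map.
by apply: eq_bigr => s _; rewrite big_allpairs_dep.
Qed.

Lemma size_trees k n : size (trees k n) = \prod_(j < n) (1 + k.+1 * j).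
Proof.
elim: n => [|n IH]; first by rewrite big_ord0.
rewrite [RHS]big_ord_recr [RHS]/= -IH -!sum1_size big_distrl.
apply: etrans (sum_trees k n (fun=> 1)) _.
apply: eq_big_seq => s /treesP[<- wf]; rewrite -sum_weight_total //.
apply: etrans (esym (mul1n _)).
by apply: eq_bigr => c _; apply: etrans (sum1_size _) _; rewrite size_iota.
Qed.

Local Open Scope ring_scope.

(** From d descendants, (k+1) d - 1 choices lead to d + 1 and the remaining ones keep d; the two
    coefficients are these counts at d = m and d = m+1. *)
Lemma sum_transition k s u m : (0 < k)%N -> wf_choices k s ->
  (0 < u <= size s)%N ->
  (\sum_(c <- iota 0 (1 + k * size s)) (count (fun q => q.1 == c) s).+1 *
     (ndesc k s u + clique_below k s u c == m.+1))%N%:R =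
  (ndesc k s u == m.+1)%:R * (k.+1%:R * ((size s)%:R - m.+1%:R) + 2)
  + (ndesc k s u == m)%:R * (k.+1%:R * m%:R - 1) :> rat.
Proof.
move=> k0 wf u_in; have := sum_weight_below k0 wf u_in.
have := sum_weight_total wf; set d := ndesc k s u.
pose w c := (count (fun q : nat * nat => q.1 == c) s).+1.
rewrite -/w; set W := (\sum_(c <- _) w c * _)%N => total belowE.
(* The choices that leave d = m+1 are added on the left, so that the identity holds in the naturals
   without subtraction. *)
have split_w : ((\sum_(c <- iota 0 (1 + k * size s))
      w c * (d + clique_below k s u c == m.+1)) + (d == m.+1) * W =
    (d == m.+1) * (1 + k.+1 * size s) + (d == m) * W)%N.
  rewrite -total !big_distrr /= -!big_split /=; apply: eq_bigr => c _.
  rewrite -/(w c); move: (w c) => x.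
  by case: clique_below; rewrite /= ?addn1 ?addn0 ?eqSS ?muln1 ?muln0; ring.
have {}belowE : W%:R = k.+1%:R * d%:R - 1 :> rat.
  by rewrite -natrM -belowE -natr1 addrK.
move/(congr1 (fun i : nat => i%:R : rat)): split_w.
rewrite !natrD !natrM belowE natrD natrM => /(canRL (addrK _)) ->.
have [->|ne1] := eqVneq d m.+1; first by rewrite (gtn_eqF (ltnSn m)) /=; ring.
by have [->|ne2] := eqVneq d m; rewrite /=; ring.
Qed.

(** * Recurrence for the number of pairs of a tree and a node with m descendants *)

Definition total_ndesc k n m : rat :=
  \sum_(s <- trees k n) (count (fun u => ndesc k s u == m) (iota 1 n))%:R.

Lemma total_ndesc0 k n : (0 < k)%N -> total_ndesc k n 0 = 0.
Proof.
move=> k0; rewrite /total_ndesc big1_seq // => s /andP[_ /treesP[sz wf]].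
rewrite (eq_in_count (a2 := pred0)) ?count_pred0 // => u; rewrite mem_iota => u_in.
have := @sum_weight_below k s u k0 wf; rewrite sz => /(_ u_in).
by case: ndesc => // ; rewrite muln0.
Qed.

(** Old nodes contribute through [sum_transition]; the new node has only itself as descendant, hence
    one extra pair per tree when m = 0. *)
Lemma total_ndescS k n m : (0 < k)%N ->
  total_ndesc k n.+1 m.+1 =
    total_ndesc k n m.+1 * (k.+1%:R * (n%:R - m.+1%:R) + 2)
  + total_ndesc k n m * (k.+1%:R * m%:R - 1)
  + (m == 0%N)%:R * (size (trees k n.+1))%:R.
Proof.
move=> k0; rewrite size_trees big_ord_recr /= -size_trees mulnC natrM.
rewrite {1}/total_ndesc sum_trees /total_ndesc !mulr_suml.
rewrite -[size (trees k n)]sum1_size natr_sum !mulr_sumr -!big_split.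
apply: eq_big_seq => s /treesP[sz wf].
have countE t : (count (fun u => ndesc k t u == m.+1) (iota 1 n))%:R =
    \sum_(u <- iota 1 n) (ndesc k t u == m.+1)%:R :> rat.
  by rewrite -sum1_count natr_sum big_mkcond; apply: eq_bigr => u _; case: eqP.
have countE' t : (count (fun u => ndesc k t u == m) (iota 1 n))%:R =
    \sum_(u <- iota 1 n) (ndesc k t u == m)%:R :> rat.
  by rewrite -sum1_count natr_sum big_mkcond; apply: eq_bigr => u _; case: eqP.
have rconsE c p : c \in iota 0 (1 + k * n) ->
    (count (fun u => ndesc k (rcons s (c, p)) u == m.+1) (iota 1 n.+1))%:R =
    \sum_(u <- iota 1 n) (ndesc k s u + clique_below k s u c == m.+1)%:R
    + (m == 0%N)%:R :> rat.
  rewrite mem_iota => c_in; have le_c : (c <= k * size s)%N by rewrite sz; lia.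
  have wf' := wf_rcons p wf le_c; rewrite iota1S count_cat natrD countE.
  congr (_ + _).
    apply: eq_big_seq => u; rewrite mem_iota => u_in.
    by rewrite ndesc_rcons // sz; lia.
  rewrite /= -{1}sz -(size_rcons s (c, p)) ndesc_last ?size_rcons // addn0.
  by rewrite eqSS eq_sym.
(* The summand does not depend on the position p, so the sum over p becomes the weight of the
   clique. *)
under eq_big_seq => c c_in.
  under eq_bigr => p _ do rewrite rconsE //.
  rewrite big_const_seq count_predT size_iota iter_addr_0.
  rewrite -[_ *+ (count _ _).+1]mulr_natl mulrDr.
  rewrite mulr_sumr.
  under eq_bigr => u _ do rewrite -natrM.
  over.
rewrite big_split /= exchange_big /= countE countE' !mulr_suml -big_split /=.
congr (_ + _); last first.
  by rewrite -mulr_suml -natr_sum -sz sum_weight_total // mulrC mulr1.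
apply: eq_big_seq => u; rewrite mem_iota => u_in.
by rewrite -natr_sum -sz sum_transition // sz; lia.
Qed.

(** * Rising factorials and alternating binomial sums *)

Definition poch (x : rat) (n : nat) : rat := \prod_(i < n) (x + i%:R).

Lemma poch0 x : poch x 0 = 1. Proof. exact: big_ord0. Qed.

Lemma pochS x n : poch x n.+1 = poch x n * (x + n%:R).
Proof. by rewrite /poch big_ord_recr. Qed.

Lemma pochSl x n : poch x n.+1 = x * poch (1 + x) n.
Proof.
rewrite /poch big_ord_recl addr0; congr (_ * _); apply: eq_bigr => i _.
by rewrite lift0 -natr1; ring.
Qed.

Lemma poch_gt0 x n : 0 < x -> 0 < poch x n.
Proof. by move=> x0; apply: prodr_gt0 => i _; rewrite ltr_wpDr. Qed.

Lemma binr_poch x n : binr (n%:R + x) n = poch (1 + x) n / n`!%:R.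
Proof.
rewrite /binr /poch (reindex_inj rev_ord_inj) /=; congr (_ / _).
by apply: eq_bigr => i _; rewrite natrB // -natr1; ring.
Qed.

(** Up to the sign (-1)^m, the m-th forward difference of x at 0. *)
Definition asum (m : nat) (x : nat -> rat) : rat :=
  \sum_(l < m.+1) 'C(m, l)%:R * (-1) ^+ l * x l.

Lemma asumS m x : asum m.+1 x = asum m x - asum m (fun l => x l.+1).
Proof.
have -> : asum m x = \sum_(l < m.+2) 'C(m, l)%:R * (-1) ^+ l * x l.
  by rewrite [RHS]big_ord_recr /= bin_small // !mul0r addr0.
rewrite /asum !(big_ord_recl m.+1) /= !bin0 -addrA; congr (_ + _).
rewrite -sumrB; apply: eq_bigr => l _; rewrite /bump /= add1n binS natrD exprS.
ring.
Qed.

Lemma eq_asum m x y : x =1 y -> asum m x = asum m y.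
Proof. by move=> xy; apply: eq_bigr => l _; rewrite xy. Qed.

Lemma asumD m x y : asum m (fun l => x l + y l) = asum m x + asum m y.
Proof. by rewrite -big_split; apply: eq_bigr => l _; rewrite mulrDr. Qed.

Lemma asumZ m c x : asum m (fun l => c * x l) = c * asum m x.
Proof. by rewrite /asum mulr_sumr; apply: eq_bigr => l _; ring. Qed.

Lemma asum_const m c : asum m (fun=> c) = (m == 0%N)%:R * c.
Proof.
case: m => [|m]; last by rewrite asumS subrr mul0r.
by rewrite /asum big_ord1 bin0 expr0 mul1r.
Qed.

(** Since (m-l) C(m,l) = m C(m-1,l), a factor m-l lowers the order of the sum; this yields the term
    of index m in the recurrence. *)
Lemma asum_lower m x :
  asum m (fun l => (m%:R - l%:R) * x l) = m%:R * asum m.-1 x.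
Proof.
case: m => [|m]; first by rewrite /asum big_ord1 subrr !(mul0r, mulr0).
rewrite /asum big_ord_recr /= subrr mul0r mulr0 addr0 mulr_sumr.
apply: eq_bigr => l _.
have := mul_bin_down m.+1 l; move/(congr1 (fun i : nat => i%:R : rat)).
rewrite !natrM natrB /=; last exact: ltnW (ltn_ord l).
by move=> binE; rewrite !mulrA binE; ring.
Qed.

(** Induction with [asumS]: shifting l by one replaces x by x+1, and the difference of the two
    quotients gains the factor m+1. *)
Lemma asum_inv m x : 0 < x ->
  asum m (fun l => (x + l%:R)^-1) = m`!%:R / poch x m.+1.
Proof.
elim: m x => [|m IH] x x0.
  by rewrite /asum big_ord1 pochS poch0 bin0 expr0 fact0 !mul1r.
rewrite asumS IH // (@eq_asum _ _ (fun l => (1 + x + l%:R)^-1)); last first.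
  by move=> l; rewrite -natr1; congr _^-1; ring.
rewrite IH; last by lra.
have eqP : x * poch (1 + x) m.+1 = poch x m.+1 * (x + m.+1%:R).
  by rewrite -pochSl pochS.
have p1 := poch_gt0 m.+1 x0.
have p2 : 0 < poch (1 + x) m.+1 by apply: poch_gt0; lra.
rewrite (pochSl x m.+1).
have xm : 0 < x + m.+1%:R by rewrite ltr_wpDr.
have -> : poch x m.+1 = x * poch (1 + x) m.+1 / (x + m.+1%:R).
  by rewrite eqP mulfK // gt_eqF.
rewrite factS natrM; field.
by rewrite nat1r !gt_eqF.
Qed.

(** * Closed form of the number of pairs *)

Lemma size_trees_poch k n :
  (size (trees k n))%:R = k.+1%:R ^+ n * poch (1 / k.+1%:R) n :> rat.
Proof.
rewrite size_trees natr_prod -[n in _ ^+ n]card_ord -prodr_const /poch.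
rewrite -big_split /=; apply: eq_bigr => i _; rewrite natrD natrM.
by field; rewrite nat1r pnatr_eq0.
Qed.

(* n! times the difference of binomials in the theorem, for a = 1/(k+1). *)
Definition gap (a : rat) (n l : nat) : rat :=
  poch (1 + a) n - poch (2 * a - 1 - l%:R) n.

(** Induction on n: the three terms of [gapS] match those of [total_ndescS], using m B(m) = (m-a)
    B(m-1) for the prefactor B(m) = poch (1-a) m / m!. *)
Lemma total_ndesc_asum k n m (a := 1 / k.+1%:R : rat) : (0 < k)%N ->
  total_ndesc k n m.+1 =
    k.+1%:R ^+ n * (poch (1 - a) m / m`!%:R)
    * asum m (fun l => a / (2 - a + l%:R) * gap a n l).
Proof.
move=> k0; have K0 : k.+1%:R != 0 :> rat by rewrite pnatr_eq0.
have aK : k.+1%:R * a = 1 by rewrite /a mulrCA mulfV // mulr1.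
have a_lt2 : a < 2 by rewrite /a ltr_pdivrMr ?ltr0n // -natrM (ltr_nat _ 1); lia.
elim: n m => [|n IH] m.
  rewrite /total_ndesc /= big_seq1 (@eq_asum _ _ (fun=> 0)).
    by rewrite asum_const !mulr0.
  by move=> l; rewrite /gap !poch0 subrr mulr0.
pose x l := a / (2 - a + l%:R) * gap a n l.
(* The gap at n+1 is (n+2a-1-l) times the gap at n plus (2-a+l) poch (1+a) n. The first factor
   splits as (n-(m+1)+2a) + (m-l); in the second term the denominator cancels, leaving a constant in
   l that survives only for m = 0. *)
have gapS : asum m (fun l => a / (2 - a + l%:R) * gap a n.+1 l) =
    (n%:R - m.+1%:R + 2 * a) * asum m x + m%:R * asum m.-1 x
    + (m == 0%N)%:R * (a * poch (1 + a) n).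
  rewrite -asum_lower -asumZ -asum_const -!asumD; apply: eq_asum => l.
  have dl : 2 - a + l%:R != 0.
    by rewrite gt_eqF // ltr_wpDr ?ler0n ?subr_gt0.
  by rewrite /x /gap !pochS -natr1; field.
rewrite total_ndescS // IH gapS size_trees_poch pochSl -/a -/x exprS.
set K := k.+1%:R in K0 aK *.
case: m gapS => [|m] _.
  rewrite total_ndesc0 // poch0 fact0 invr1 /= !mul0r addr0.
  have -> : a = K^-1 by rewrite /a mul1r.
  by field; rewrite nat1r.
rewrite IH -/a -/x pochS factS natrM /= -/K.
have aE : a = K^-1 by rewrite /a mul1r.
rewrite mul0r mul0r !addr0 -[m.+2%:R]natr1 -[m.+1%:R]natr1.
move: (asum _ _) (asum _ _) (poch _ _) => u v w; rewrite aE; field.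
by rewrite nat1r natr1 !pnatr_eq0 -!lt0n fact_gt0.
Qed.

(** * Rational limits with an error of order 1/n *)

Definition near_inv (f : nat -> rat) (L : rat) : Prop :=
  exists C N, forall n, (N <= n)%N -> `|f n - L| <= C / n%:R.

Lemma near_invZ c f L : near_inv f L -> near_inv (fun n => c * f n) (c * L).
Proof.
move=> [C [N fL]]; exists (`|c| * C), N => n /fL le.
by rewrite -mulrBr normrM -mulrA ler_wpM2l.
Qed.

Lemma near_invD f g L M : near_inv f L -> near_inv g M ->
  near_inv (fun n => f n + g n) (L + M).
Proof.
move=> [C [N fL]] [D [P gM]]; exists (C + D), (maxn N P) => n.
rewrite geq_max => /andP[/fL le1 /gM le2].
by rewrite mulrDl opprD addrACA (le_trans (ler_normD _ _)) // lerD.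
Qed.

Lemma near_inv_sum m (f : nat -> nat -> rat) (L : nat -> rat) :
  (forall l, near_inv (f l) (L l)) ->
  near_inv (fun n => \sum_(l < m) f l n) (\sum_(l < m) L l).
Proof.
move=> fL; elim: m => [|m [C [N IH]]].
  by exists 0, 0%N => n _; rewrite !big_ord0 subrr normr0 mul0r.
have [D [P H]] : near_inv (fun n => \sum_(l < m) f l n + f m n)
    (\sum_(l < m) L l + L m) by apply: near_invD => //; exists C, N.
by exists D, P => n /H; rewrite !big_ord_recr.
Qed.

Lemma near_inv_eps f L : near_inv f L -> forall eps, 0 < eps ->
  exists N, forall n, (N <= n)%N -> `|f n - L| < eps.
Proof.
move=> [C [N fL]] eps eps0.
exists (maxn N (Num.bound `|C / eps|).+1) => n.
rewrite geq_max => /andP[/fL le le_n]; apply: le_lt_trans le _.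
have n0 : 0 < n%:R :> rat by rewrite ltr0n; lia.
rewrite ltr_pdivrMr // mulrC -ltr_pdivrMr //.
apply: le_lt_trans (ler_norm _) _; apply: lt_trans (archi_boundP _) _ => //.
by rewrite ltr_nat.
Qed.

(** From index N on, each new factor satisfies 0 <= x+n <= a+n, so the ratio of the products does
    not increase; C is its value at N. *)
Lemma poch_dominated (x a : rat) N : 0 < a -> x <= a -> 0 <= x + N%:R ->
  exists C, forall n, (N <= n)%N -> `|poch x n| <= C * poch a n.
Proof.
move=> a0 xa xN; exists (`|poch x N| / poch a N) => n.
elim: n => [|n IH] leN.
  by move: leN; rewrite leqn0 => /eqP->; rewrite !poch0 divr1 mulr1.
move: leN; rewrite leq_eqVlt => /orP[/eqP<-|].
  by rewrite divfK // gt_eqF // poch_gt0.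
rewrite ltnS => leN; rewrite !pochS normrM mulrA; apply: ler_pM => //.
  exact: IH.
have le_Nn : N%:R <= n%:R :> rat by rewrite ler_nat.
by rewrite ger0_norm; lra.
Qed.

(** By poch (1+a) n = poch a n (a+n) / a, the first product contributes exactly 1/a + 1/n; the
    second is O(1/n) by domination. *)
Lemma gap_ratio a l : 0 < a -> a < 1 ->
  near_inv (fun n => gap a n l / (n%:R * poch a n)) a^-1.
Proof.
move=> a0 a1.
have l0 : 0 <= l%:R :> rat by [].
(* Here 2a-1-l <= a because a < 1, and adding l+1 gives 2a >= 0. *)
have [C Cle] : exists C, forall n, (l.+1 <= n)%N ->
    `|poch (2 * a - 1 - l%:R) n| <= C * poch a n.
  by apply: poch_dominated; rewrite -?natr1; lra.
exists (1 + C), l.+1 => n ln.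
have n0 : 0 < n%:R :> rat by rewrite ltr0n; lia.
have t0 := poch_gt0 n a0.
have P_E : poch (1 + a) n = poch a n * (a + n%:R) / a.
  by rewrite -pochS pochSl mulrAC mulfV ?gt_eqF // mul1r.
have -> : gap a n l / (n%:R * poch a n) - a^-1 =
    (1 - poch (2 * a - 1 - l%:R) n / poch a n) / n%:R.
  by rewrite /gap P_E; field; rewrite !gt_eqF.
rewrite normrM normfV (ger0_norm (ltW n0)) ler_pM2r ?invr_gt0 //.
apply: le_trans (ler_normB _ _) _; rewrite normr1 lerD2l.
by rewrite normrM normfV (gtr0_norm t0) ler_pdivrMr ?Cle.
Qed.

(** * The exact probability and its limit *)

Lemma probXbar_asum k n m (a := 1 / k.+1%:R : rat) : (0 < k)%N ->
  probXbar k n m.+1 = poch (1 - a) m / m`!%:R *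
    asum m (fun l => a / (2 - a + l%:R) * (gap a n l / (n%:R * poch a n))).
Proof.
move=> k0; have K0 : k.+1%:R != 0 :> rat by rewrite pnatr_eq0.
rewrite /probXbar -/(total_ndesc k n m.+1) total_ndesc_asum // natrM.
rewrite size_trees_poch -/a.
(* Once the normalisation is pulled out of the sum, only the powers of k+1 remain to cancel. *)
rewrite [in RHS](@eq_asum _ _
  (fun l => (n%:R * poch a n)^-1 * (a / (2 - a + l%:R) * gap a n l))); last first.
  by move=> l; ring.
rewrite asumZ; move: (asum _ _) (poch a n) (poch _ _ / _) => S t B.
have Kn0 := expf_neq0 n K0; rewrite !invfM; move: (_ ^+ n) Kn0 => p p0.
transitivity (p / p * (B * (n%:R^-1 / t * S))); first by ring.
by rewrite mulfV // mul1r.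
Qed.

Theorem theorem6 (k : nat) (hk : (1 <= k)%N) :
  (forall n m : nat, (1 <= n)%N -> (1 <= m)%N ->
     probXbar k n m =
       binr ((m.-1)%:R - 1 / (k.+1)%:R) m.-1
         / (n%:R * binr (n%:R - k%:R / (k.+1)%:R) n)
       * \sum_(l < m)
           (('C(m.-1, l))%:R * (-1) ^+ l / ((k.+1 * l.+1 + k)%N)%:R
            * (binr (n%:R + 1 / (k.+1)%:R) n
               - binr (n%:R - (l : nat)%:R - 2 + 2 / (k.+1)%:R) n)))
  /\
  (forall m : nat, (1 <= m)%N ->
     forall eps : rat, 0 < eps ->
       exists N : nat, forall n : nat, (N <= n)%N ->
         `|probXbar k n m
           - k%:R / ((k.+1)%:R * (m%:R + k%:R / (k.+1)%:R)
                                 * (m%:R - 1 / (k.+1)%:R))| < eps).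
Proof.
pose a : rat := 1 / k.+1%:R.
have K0 : 0 < k.+1%:R :> rat by rewrite ltr0n.
have a0 : 0 < a by rewrite divr_gt0.
have a1 : a < 1 by rewrite ltr_pdivrMr // mul1r ltr1n.
have kK : k%:R = k.+1%:R - 1 :> rat by rewrite -natr1 addrK.
have aE : k%:R / k.+1%:R = 1 - a.
  by rewrite kK mulrBl mulfV ?gt_eqF.
split=> [n [//|m] n_gt0 _ | [//|m] _ eps eps0].
  rewrite probXbar_asum // -/a aE.
  have -> : n%:R - (1 - a) = n%:R + (a - 1) by ring.
  rewrite !binr_poch addrCA subrr addr0 /asum !mulr_sumr /=.
  apply: eq_bigr => l _; rewrite /gap.
  have -> : n%:R - l%:R - 2 + 2 / k.+1%:R = n%:R + (2 * a - 2 - l%:R).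
    by rewrite /a; ring.
  rewrite binr_poch (_ : 1 + (2 * a - 2 - l%:R) = 2 * a - 1 - l%:R); last by ring.
  (* Dividing by k+1 and using k/(k+1) = 1-a gives (l+1) + (1-a) = 2-a+l. *)
  have dE : (k.+1 * l.+1 + k)%:R = (2 - a + l%:R) / a :> rat.
    rewrite natrD natrM kK -natr1 /a; field.
    by rewrite nat1r gt_eqF.
  rewrite dE; have t0 := poch_gt0 n a0.
  have n0 : 0 < n%:R :> rat by rewrite ltr0n.
  have d0 : 0 < 2 - a + l%:R by rewrite ltr_wpDr // subr_gt0; lra.
  have nf0 : 0 < n`!%:R :> rat by rewrite ltr0n fact_gt0.
  have mf0 : 0 < m`!%:R :> rat by rewrite ltr0n fact_gt0.
  move: (2 - a + l%:R) d0 => d d0.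
  field; rewrite ?gt_eqF //.
apply: near_inv_eps eps0.
(* Each normalised gap tends to 1/a, which cancels the factor a; the limiting sum is [asum_inv] at x
   = 2-a. *)
have -> : k%:R / (k.+1%:R * (m.+1%:R + k%:R / k.+1%:R) * (m.+1%:R - 1 / k.+1%:R)) =
  poch (1 - a) m / m`!%:R * asum m (fun l => (2 - a + l%:R)^-1).
  rewrite asum_inv; last by lra.
  (* Both sides are poch (1-a) (m+2); the prefactor cancels all but its last two factors, which are
     the two factors in the stated limit. *)
  have pE : (1 - a) * poch (2 - a) m.+1 =
      poch (1 - a) m * (1 - a + m%:R) * (1 - a + m.+1%:R).
    by rewrite -!pochS (pochSl (1 - a)); congr (_ * poch _ _); ring.
  have a1' : 0 < 1 - a by rewrite subr_gt0.
  have m0 : 0 <= m%:R :> rat by [].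
  rewrite [poch (2 - a) _](_ : _ = poch (1 - a) m * (1 - a + m%:R) *
      (1 - a + m.+1%:R) / (1 - a)); last by rewrite -pE mulrAC mulfV ?gt_eqF ?mul1r.
  have p0 := poch_gt0 m a1'.
  have f0 : 0 < m`!%:R :> rat by rewrite ltr0n fact_gt0.
  rewrite -/a !invfM !mulrA aE.
  rewrite -natr1; field.
  by rewrite !gt_eqF //; lra.
have [C [N H]] : near_inv (fun n => poch (1 - a) m / m`!%:R *
    asum m (fun l => a / (2 - a + l%:R) * (gap a n l / (n%:R * poch a n))))
    (poch (1 - a) m / m`!%:R * asum m (fun l => (2 - a + l%:R)^-1)).
  apply/near_invZ/(@near_inv_sum m.+1 (fun l n => 'C(m, l)%:R * (-1) ^+ l *
      (a / (2 - a + l%:R) * (gap a n l / (n%:R * poch a n))))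
    (fun l => 'C(m, l)%:R * (-1) ^+ l * (2 - a + l%:R)^-1)) => l /=.
  apply: near_invZ.
  rewrite -[X in near_inv _ X](_ : a / (2 - a + l%:R) * a^-1 = _).
    by apply: near_invZ; exact: gap_ratio.
  by rewrite mulrAC mulfV ?gt_eqF // mul1r.
by exists C, N => n /H; rewrite probXbar_asum.
Qed.
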